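(* For any $\varepsilon>0$ there exists a two-player extensive-form game $\Gamma$ such that $\Gamma$ has, up to realization equivalence, a unique CDT equilibrium, and such that for every CDT equilibrium $\pi$ of $\Gamma$, every CDT equilibrium $\pi'$ of $\mathrm{pr}_1(\Gamma)$, and both players $i\in\{1,2\}$, $U_i(\pi')/U_i(\pi)\le\varepsilon$. In particular, $\mathrm{VoR}^{\mathrm{SC}}(\Gamma)=0$ for every $\mathrm{SC}\in\{\mathrm{wCDT},\mathrm{bCDT},\mathrm{wEDT},\mathrm{bEDT},\mathrm{wNash},\mathrm{bNash}\}$.
   Context: An extensive-form game consists of a finite rooted tree (nodes $\mathcal H$, leaves $\mathcal Z$, actions $A_h$), players $\mathcal N$ plus chance, an assignment of nonterminal nodes to players or chance, chance distributions, utilities $u_i:\mathcal Z\to\mathbb R_{\ge0}$, and for each $i$ a partition $\mathcal I_i$ of its nodes into infosets with common action sets $A_I$. For a node $h$, $\mathrm{obs}_1(h)$ is the sequence of (infoset, action) pairs at Player 1's nodes on the root-to-$h$ path (excluding $h$). $\mathrm{pr}_1(\Gamma)$ has the same tree and utilities as $\Gamma$, with each $I\in\mathcal I_1$ partitioned into the classes of $h\sim h'\iff\mathrm{obs}_1(h)=\mathrm{obs}_1(h')$ (computed in $\Gamma$) and other players' infosets unchanged. A behavioral strategy $\pi_i$ assigns $\pi_i(\cdot\mid I)\in\Delta(A_I)$ to each $I\in\mathcal I_i$; $S_i$ is the set of these; $U_i(\pi)=\sum_z\mathbb P(z\mid\pi)u_i(z)$ with $\mathbb P(z\mid\pi)$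 the reach probability of $z$. Profiles are realization-equivalent if they induce the same reach probabilities at all nodes. $\pi_i^{I\mapsto\sigma}$ plays $\sigma$ at $I$ and as $\pi_i$ elsewhere. Nash equilibrium: each $\pi_i\in\arg\max_{\pi_i'}U_i(\pi_i',\pi_{-i})$. EDT equilibrium: for all $i$, $I\in\mathcal I_i$, $\pi_i(\cdot\mid I)\in\arg\max_{\sigma\in\Delta(A_I)}U_i(\pi_i^{I\mapsto\sigma},\pi_{-i})$. CDT equilibrium: each $\pi_i$ is a Karush–Kuhn–Tucker point of maximizing $U_i(\cdot,\pi_{-i})$ over $S_i=\prod_I\Delta(A_I)$. For X in {Nash, EDT, CDT}, $u_1(\mathrm{bX}(\Gamma))$ / $u_1(\mathrm{wX}(\Gamma))$ is the max / min of $U_1$ over X equilibria of $\Gamma$; $\mathrm{VoR}^{\mathrm{SC}}(\Gamma)=u_1(\mathrm{SC}(\mathrm{pr}_1(\Gamma)))/u_1(\mathrm{SC}(\Gamma))$. *)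

(* Defs.v *)
From Stdlib Require Import Reals Lra List Arith.
From Coquelicot Require Import Coquelicot.
Import ListNotations.
Open Scope R_scope.

Inductive player := P1 | P2.

Definition player_eq_dec (i j : player) : {i = j} + {i <> j}.
Proof. decide equality. Defined.

(** Finite rooted trees.  Actions at a node are the indices
    0, ..., (number of children - 1).  Player nodes carry an infoset label
    of type [L]; all nodes with the same label form one infoset. *)
Inductive tree (L : Type) : Type :=
| Leaf : R -> R -> tree L                         (* utilities u_1, u_2 *)
| Chance : list (R * tree L) -> tree L            (* (probability, child) *)
| Dec : player -> L -> list (tree L) -> tree L.

Arguments Leaf {L} _ _.
Arguments Chance {L} _.
Arguments Dec {L} _ _ _.

Record game := Game {
  lab : Type;
  lab_dec : forall x y : lab, {x = y} + {x <> y};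
  root : tree lab
}.

(** Nodes are addressed by paths (sequences of action indices) from the root. *)
Fixpoint subtree {L} (t : tree L) (p : list nat) : option (tree L) :=
  match p with
  | [] => Some t
  | k :: p' =>
    match t with
    | Leaf _ _ => None
    | Chance bs => match nth_error bs k with
                   | Some (_, c) => subtree c p'
                   | None => None end
    | Dec _ _ ch => match nth_error ch k with
                    | Some c => subtree c p'
                    | None => None end
    end
  end.

Definition is_node (G : game) (p : list nat) : Prop :=
  exists t, subtree (root G) p = Some t.

Definition is_infoset (G : game) (i : player) (I : lab G) (n : nat) : Prop :=
  exists p ch, subtree (root G) p = Some (Dec i I ch) /\ length ch = n.

Definition sumR (l : list R) : R := fold_right Rplus 0 l.

Definition sum_lt (n : nat) (f : nat -> R) : R := sumR (map f (seq 0 n)).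

Definition wf_game (G : game) : Prop :=
  (forall p o I ch, subtree (root G) p = Some (Dec o I ch) -> ch <> []) /\
  (forall p bs, subtree (root G) p = Some (Chance bs) ->
     List.Forall (fun qc => 0 <= fst qc) bs /\ sumR (map fst bs) = 1) /\
  (forall p u1 u2, subtree (root G) p = Some (Leaf u1 u2) -> 0 <= u1 /\ 0 <= u2) /\
  (forall p1 p2 o1 o2 I ch1 ch2,
     subtree (root G) p1 = Some (Dec o1 I ch1) ->
     subtree (root G) p2 = Some (Dec o2 I ch2) ->
     o1 = o2 /\ length ch1 = length ch2).

Fixpoint leaves {L} (t : tree L) : list (list nat * (R * R)) :=
  match t with
  | Leaf u1 u2 => [([], (u1, u2))]
  | Chance bs =>
    (fix go (k : nat) (bs : list (R * tree L)) :=
       match bs with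
       | [] => []
       | (_, c) :: bs' =>
           map (fun zu => (k :: fst zu, snd zu)) (leaves c) ++ go (S k) bs'
       end) 0%nat bs
  | Dec _ _ ch =>
    (fix go (k : nat) (ch : list (tree L)) :=
       match ch with
       | [] => []
       | c :: ch' =>
           map (fun zu => (k :: fst zu, snd zu)) (leaves c) ++ go (S k) ch'
       end) 0%nat ch
  end.

(** Strategy profiles: [pi i I a] is the probability player [i] assigns to
    action [a] at infoset [I]. Values outside of player [i]'s infosets and
    action ranges are irrelevant. *)
Definition profile (G : game) := player -> lab G -> nat -> R.

Fixpoint reach {L} (pi : player -> L -> nat -> R) (t : tree L) (p : list nat) : R :=
  match p with
  | [] => 1
  | k :: p' =>
    match t with
    | Leaf _ _ => 0
    | Chance bs => match nth_error bs k with
                   | Some (q, c) => q * reach pi c p'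
                   | None => 0 end
    | Dec o J ch => match nth_error ch k with
                    | Some c => pi o J k * reach pi c p'
                    | None => 0 end
    end
  end.

Definition util (i : player) (u : R * R) : R :=
  match i with P1 => fst u | P2 => snd u end.

Definition U (G : game) (i : player) (pi : profile G) : R :=
  sumR (map (fun zu => reach pi (root G) (fst zu) * util i (snd zu))
            (leaves (root G))).

Definition is_distr (n : nat) (s : nat -> R) : Prop :=
  (forall a, (a < n)%nat -> 0 <= s a) /\ sum_lt n s = 1.

Definition behavioral (G : game) (i : player) (s : lab G -> nat -> R) : Prop :=
  forall I n, is_infoset G i I n -> is_distr n (s I).

Definition valid_profile (G : game) (pi : profile G) : Prop :=
  forall i, behavioral G i (pi i).

Definition set_player (G : game) (pi : profile G) (i : player)
  (s : lab G -> nat -> R) : profile G :=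
  fun j => if player_eq_dec j i then s else pi j.

Definition set_infoset (G : game) (pi : profile G) (i : player) (I : lab G)
  (sigma : nat -> R) : profile G :=
  set_player G pi i (fun J => if lab_dec G J I then sigma else pi i J).

Definition set_coord (G : game) (pi : profile G) (i : player) (I : lab G)
  (a : nat) (t : R) : profile G :=
  set_infoset G pi i I (fun b => if Nat.eq_dec b a then t else pi i I b).

Definition realization_equiv (G : game) (pi pi' : profile G) : Prop :=
  forall p, is_node G p -> reach pi (root G) p = reach pi' (root G) p.

Definition nash_eq (G : game) (pi : profile G) : Prop :=
  valid_profile G pi /\
  forall i s, behavioral G i s -> U G i (set_player G pi i s) <= U G i pi.

Definition edt_eq (G : game) (pi : profile G) : Prop :=
  valid_profile G pi /\
  forall i I n, is_infoset G i I n ->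
    forall sigma, is_distr n sigma ->
      U G i (set_infoset G pi i I sigma) <= U G i pi.

(** KKT point of maximizing U_i(., pi_{-i}) over S_i = prod_I Delta(A_I),
    the constraints being pi_i(a|I) >= 0 and sum_a pi_i(a|I) = 1.
    Partial derivatives are taken of the polynomial U_i viewed as a function
    of the coordinates pi_i(a|I). *)
Definition KKT_point (G : game) (i : player) (pi : profile G) : Prop :=
  behavioral G i (pi i) /\
  exists (lam : lab G -> R) (mu : lab G -> nat -> R),
    forall I n, is_infoset G i I n ->
      forall a, (a < n)%nat ->
        0 <= mu I a /\ mu I a * pi i I a = 0 /\
        Derive (fun t => U G i (set_coord G pi i I a t)) (pi i I a)
          = lam I - mu I a.

Definition cdt_eq (G : game) (pi : profile G) : Prop :=
  forall i, KKT_point G i pi.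

(** Player 1's infoset I is refined by obs_1; the new label of a Player-1 node
    is (I, obs_1(h)).  Player 2's infosets are unchanged (label (I, [])). *)
Fixpoint pr1_tree {L} (obs : list (L * nat)) (t : tree L) : tree (L * list (L * nat)) :=
  match t with
  | Leaf u1 u2 => Leaf u1 u2
  | Chance bs =>
    Chance ((fix go (bs : list (R * tree L)) :=
               match bs with
               | [] => []
               | (q, c) :: bs' => (q, pr1_tree obs c) :: go bs'
               end) bs)
  | Dec P1 J ch =>
    Dec P1 (J, obs)
      ((fix go (k : nat) (ch : list (tree L)) :=
          match ch with
          | [] => []
          | c :: ch' => pr1_tree (obs ++ [(J, k)]) c :: go (S k) ch'
          end) 0%nat ch)
  | Dec P2 J ch =>
    Dec P2 (J, [])
      ((fix go (ch : list (tree L)) :=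
          match ch with
          | [] => []
          | c :: ch' => pr1_tree obs c :: go ch'
          end) ch)
  end.

Definition pr1_lab_dec (G : game) :
  forall x y : lab G * list (lab G * nat), {x = y} + {x <> y}.
Proof.
  pose proof (lab_dec G) as d.
  assert (dp : forall x y : lab G * nat, {x = y} + {x <> y}).
  { intros [a b] [c e]; destruct (d a c), (Nat.eq_dec b e); subst;
      [left; reflexivity | right; congruence | right; congruence | right; congruence]. }
  intros [a l] [c l'].
  destruct (d a c), (list_eq_dec dp l l'); subst;
    [left; reflexivity | right; congruence | right; congruence | right; congruence].
Defined.

Definition pr1 (G : game) : game :=
  Game (lab G * list (lab G * nat)) (pr1_lab_dec G) (pr1_tree [] (root G)).

Inductive sol_concept := wCDT | bCDT | wEDT | bEDT | wNash | bNash.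

Definition sc_eq (SC : sol_concept) : forall G : game, profile G -> Prop :=
  match SC with
  | wCDT | bCDT => cdt_eq
  | wEDT | bEDT => edt_eq
  | wNash | bNash => nash_eq
  end.

Definition sc_best (SC : sol_concept) : bool :=
  match SC with bCDT | bEDT | bNash => true | _ => false end.

(** [sc_value SC G v]: v = u_1(SC(G)), i.e. v is the max (for bX) / min (for wX)
    of U_1 over the X equilibria of G (in particular this value is attained). *)
Definition sc_value (SC : sol_concept) (G : game) (v : R) : Prop :=
  (exists pi, sc_eq SC G pi /\ U G P1 pi = v) /\
  (forall pi, sc_eq SC G pi ->
     if sc_best SC then U G P1 pi <= v else v <= U G P1 pi).

Definition VoR (SC : sol_concept) (G : game) (r : R) : Prop :=
  exists v v', sc_value SC G v /\ sc_value SC (pr1 G) v' /\ v <> 0 /\ r = v' / v.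

(* Main.v *)
(* Player 1 is absent-minded: the root and the node reached after (continue, continue)
   share one infoset, where at the second visit Player 1 may grab 3/2 instead of 1,
   leaving Player 2 with 0; before that, Player 2 can end the game at (d, d).
   In the game itself the marginal value of continuing counts both visits, so at every
   KKT point Player 1 continues with certainty, Player 2 then continues too, and both
   get 1.  In pr_1 the second visit becomes its own infoset, where Player 1 grabs 3/2
   whenever it is reached; so Player 2 exits and both get d.  EDT and Nash equilibria
   give Player 1 the same payoffs (pure deviations already force them), and
   d = min(eps, 1/2) makes every ratio at most eps. *)

Require Import Defs.
From Stdlib Require Import Reals Lra Psatz List Bool.
From Coquelicot Require Import Coquelicot.
Import ListNotations.
Open Scope R_scope.

Definition pure (k a : nat) : R := if Nat.eqb a k then 1 else 0.

Lemma is_distr_two (s : nat -> R) :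
  is_distr 2 s <-> 0 <= s 0%nat /\ 0 <= s 1%nat /\ s 0%nat + s 1%nat = 1.
Proof.
  unfold is_distr, sum_lt; simpl; split.
  - intros [Hnn Hsum]; repeat split; [apply Hnn; lia | apply Hnn; lia | lra].
  - intros (H0 & H1 & Hsum); split; [intros [|[|a]] Ha; [exact H0 | exact H1 | lia] | lra].
Qed.

Lemma pure_is_distr_two (k : nat) : (k < 2)%nat -> is_distr 2 (pure k).
Proof.
  intros Hk; apply is_distr_two; unfold pure.
  destruct k as [|[|k]]; simpl; lra || lia.
Qed.

Definition partialU (G : game) (i : player) (pi : profile G) (I : lab G) (a : nat) : R :=
  Derive (fun t => U G i (set_coord G pi i I a t)) (pi i I a).

Lemma KKT_point_support_max {G : game} {i : player} {pi : profile G} {I : lab G} {n : nat} :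
  KKT_point G i pi -> is_infoset G i I n ->
  forall a b, (a < n)%nat -> (b < n)%nat ->
  0 < pi i I a -> partialU G i pi I b <= partialU G i pi I a.
Proof.
  intros [_ [lam [mu Hkkt]]] HI a b Ha Hb Hpos; unfold partialU.
  destruct (Hkkt I n HI a Ha) as (_ & Hslack & ->).
  destruct (Hkkt I n HI b Hb) as (Hmu & _ & ->).
  assert (mu I a = 0) by nra.
  lra.
Qed.

Lemma nash_eq_edt_eq (G : game) (pi : profile G) : wf_game G -> nash_eq G pi -> edt_eq G pi.
Proof.
  intros (_ & _ & _ & Hsame) [Hvalid Hbest]; split; [exact Hvalid |].
  intros i I n HI sigma Hsigma; apply Hbest.
  intros J m HJ; destruct (lab_dec G J I) as [-> | _]; [| exact (Hvalid i J m HJ)].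
  destruct HI as (p & ch & Hp & <-), HJ as (q & ch' & Hq & <-).
  destruct (Hsame _ _ _ _ _ _ _ Hp Hq) as [_ <-]; exact Hsigma.
Qed.

Lemma reach_ext_decisions {L : Type} (pi pi' : player -> L -> nat -> R) (t : tree L) :
  (forall q o J ch k c, subtree t q = Some (Dec o J ch) -> nth_error ch k = Some c ->
     pi o J k = pi' o J k) ->
  forall p, reach pi t p = reach pi' t p.
Proof.
  intros Hagree p; revert t Hagree; induction p as [|k p IH]; intros t Hagree;
    [reflexivity |].
  destruct t as [u1 u2 | bs | o J ch]; simpl; [reflexivity | |].
  - destruct (nth_error bs k) as [[w c] |] eqn:Hk; [| reflexivity].
    f_equal; apply IH; intros q o J ch k' c' Hq Hc.
    apply (Hagree (k :: q) o J ch k' c'); [simpl; rewrite Hk |]; assumption.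
  - destruct (nth_error ch k) as [c |] eqn:Hk; [| reflexivity].
    rewrite (Hagree [] o J ch k c eq_refl Hk); f_equal; apply IH.
    intros q o' J' ch' k' c' Hq Hc.
    apply (Hagree (k :: q) o' J' ch' k' c'); [simpl; rewrite Hk |]; assumption.
Qed.

Lemma KKT_point_of_best_response (G : game) (i : player) (pi : profile G)
    (best : lab G -> nat) :
  behavioral G i (pi i) ->
  (forall I n a, is_infoset G i I n -> (a < n)%nat ->
     partialU G i pi I a <= partialU G i pi I (best I) /\
     (pi i I a = 0 \/ partialU G i pi I a = partialU G i pi I (best I))) ->
  KKT_point G i pi.
Proof.
  intros Hbeh Hbest; split; [exact Hbeh |].
  exists (fun I => partialU G i pi I (best I)),
         (fun I a => partialU G i pi I (best I) - partialU G i pi I a).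
  intros I n HI a Ha; fold (partialU G i pi I a).
  destruct (Hbest I n a HI Ha) as [Hle Hslack]; repeat split; [lra | | ring].
  destruct Hslack as [-> | ->]; ring.
Qed.

Ltac enum_subtree H :=
  lazymatch type of H with
  | subtree _ ?p = _ =>
      destruct p as [|?k ?p]; simpl in H;
      [ | destruct k as [|[|[|?k]]]; simpl in H; try discriminate; try enum_subtree H]
  end.

(* Action 0 continues, action 1 exits. *)
Definition absent_tree (d : R) : tree bool :=
  Dec P1 true [Dec P2 false [Dec P1 true [Leaf 1 1; Leaf (3/2) 0]; Leaf d d]; Leaf 0 0].

Definition absent_game (d : R) : game := Game bool bool_dec (absent_tree d).

(* The labels that pr1 gives to Player 1's first and second visit and to Player 2's node. *)
Notation visit1 := ((true, []) : bool * list (bool * nat)).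
Notation visit2 := ((true, [(true, 0%nat)]) : bool * list (bool * nat)).
Notation turn2 := ((false, []) : bool * list (bool * nat)).

Ltac compute_partial :=
  unfold partialU, U, set_coord, set_infoset, set_player; simpl;
  apply is_derive_unique; auto_derive; [exact I | ring].

Ltac wf_by_enumeration :=
  unfold absent_game, absent_tree; split; [| split; [| split]]; simpl;
  [ intros p o I ch Hp; enum_subtree Hp; try discriminate Hp;
      injection Hp; intros; subst; discriminate
  | intros p bs Hp; enum_subtree Hp; discriminate
  | intros p u1 u2 Hp; enum_subtree Hp; try discriminate Hp;
      injection Hp; intros; subst; lra
  | intros p1 p2 o1 o2 I ch1 ch2 H1 H2;
      enum_subtree H1; try discriminate H1; injection H1; intros; subst;
      enum_subtree H2; try discriminate H2; injection H2; intros; subst;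
      try discriminate; auto ].

Section AbsentMinded.

Variable d : R.

Let G := absent_game d.

Lemma absent_game_wf : 0 <= d -> wf_game G.
Proof. intros Hd; unfold G; wf_by_enumeration. Qed.

Lemma pr1_absent_game_wf : 0 <= d -> wf_game (pr1 G).
Proof. intros Hd; unfold G; wf_by_enumeration. Qed.

Lemma absent_game_infoset {i : player} {I : bool} {n : nat} :
  is_infoset G i I n -> n = 2%nat /\ (i = P1 /\ I = true \/ i = P2 /\ I = false).
Proof.
  intros (p & ch & Hp & <-); unfold G, absent_game, absent_tree in Hp; simpl in Hp.
  enum_subtree Hp; try discriminate Hp; injection Hp; intros; subst; auto.
Qed.

Lemma absent_game_infoset_P1 : is_infoset G P1 true 2.
Proof. exists []; eexists; split; reflexivity. Qed.

Lemma absent_game_infoset_P2 : is_infoset G P2 false 2.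
Proof. exists [0%nat]; eexists; split; reflexivity. Qed.

Lemma pr1_absent_game_infoset_visit1 : is_infoset (pr1 G) P1 visit1 2.
Proof. exists []; eexists; split; reflexivity. Qed.

Lemma pr1_absent_game_infoset_visit2 : is_infoset (pr1 G) P1 visit2 2.
Proof. exists [0%nat; 0%nat]; eexists; split; reflexivity. Qed.

Lemma pr1_absent_game_infoset_turn2 : is_infoset (pr1 G) P2 turn2 2.
Proof. exists [0%nat]; eexists; split; reflexivity. Qed.

Section Utilities.

Variable pi : profile G.
Let x a := pi P1 true a.
Let y a := pi P2 false a.

Lemma U_absent_game_P1 :
  U G P1 pi = x 0%nat * (y 0%nat * (x 0%nat + 3/2 * x 1%nat) + y 1%nat * d).
Proof. unfold U, x, y; simpl; ring. Qed.

Lemma U_absent_game_P2 : U G P2 pi = x 0%nat * (y 0%nat * x 0%nat + y 1%nat * d).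
Proof. unfold U, x, y; simpl; ring. Qed.

Lemma partialU_absent_game_P1 :
  partialU G P1 pi true 0 = 2 * x 0%nat * y 0%nat + 3/2 * x 1%nat * y 0%nat + d * y 1%nat /\
  partialU G P1 pi true 1 = 3/2 * x 0%nat * y 0%nat.
Proof. unfold x, y; split; compute_partial. Qed.

Lemma partialU_absent_game_P2 :
  partialU G P2 pi false 0 = x 0%nat * x 0%nat /\ partialU G P2 pi false 1 = d * x 0%nat.
Proof. unfold x, y; split; compute_partial. Qed.

End Utilities.

Section Pr1Utilities.

Variable pi : profile (pr1 G).
Let x a := pi P1 visit1 a.
Let z a := pi P1 visit2 a.
Let y a := pi P2 turn2 a.

Lemma U_pr1_absent_game_P1 :
  U (pr1 G) P1 pi = x 0%nat * (y 0%nat * (z 0%nat + 3/2 * z 1%nat) + y 1%nat * d).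
Proof. unfold U, x, y, z; simpl; ring. Qed.

Lemma U_pr1_absent_game_P2 : U (pr1 G) P2 pi = x 0%nat * (y 0%nat * z 0%nat + y 1%nat * d).
Proof. unfold U, x, y, z; simpl; ring. Qed.

Lemma partialU_pr1_absent_game_visit1 :
  partialU (pr1 G) P1 pi visit1 0 = y 0%nat * (z 0%nat + 3/2 * z 1%nat) + y 1%nat * d /\
  partialU (pr1 G) P1 pi visit1 1 = 0.
Proof. unfold x, y, z; split; compute_partial. Qed.

Lemma partialU_pr1_absent_game_visit2 :
  partialU (pr1 G) P1 pi visit2 0 = x 0%nat * y 0%nat /\
  partialU (pr1 G) P1 pi visit2 1 = 3/2 * x 0%nat * y 0%nat.
Proof. unfold x, y, z; split; compute_partial. Qed.

Lemma partialU_pr1_absent_game_turn2 :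
  partialU (pr1 G) P2 pi turn2 0 = x 0%nat * z 0%nat /\
  partialU (pr1 G) P2 pi turn2 1 = d * x 0%nat.
Proof. unfold x, y, z; split; compute_partial. Qed.

End Pr1Utilities.

Hypothesis d_pos : 0 < d.
Hypothesis d_lt1 : d < 1.

Section Equilibria.

Variable pi : profile G.
Let x a := pi P1 true a.
Let y a := pi P2 false a.

Lemma cdt_eq_absent_game :
  cdt_eq G pi -> x 0%nat = 1 /\ x 1%nat = 0 /\ y 0%nat = 1 /\ y 1%nat = 0.
Proof.
  intros Hcdt.
  pose proof (KKT_point_support_max (Hcdt P1) absent_game_infoset_P1) as Hx.
  pose proof (KKT_point_support_max (Hcdt P2) absent_game_infoset_P2) as Hy.
  destruct (proj1 (is_distr_two _) (proj1 (Hcdt P1) _ _ absent_game_infoset_P1))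
    as (Hx0 & Hx1 & Hxsum).
  destruct (proj1 (is_distr_two _) (proj1 (Hcdt P2) _ _ absent_game_infoset_P2))
    as (Hy0 & Hy1 & Hysum).
  destruct (partialU_absent_game_P1 pi) as [Dx0 Dx1].
  destruct (partialU_absent_game_P2 pi) as [Dy0 Dy1].
  fold (x 0%nat) (x 1%nat) (y 0%nat) (y 1%nat) in *.
  assert (Hexit : x 1%nat = 0).
  { destruct (Rle_lt_or_eq_dec 0 (x 1%nat) Hx1) as [Hpos | <-]; [exfalso | reflexivity].
    specialize (Hx 1%nat 0%nat ltac:(lia) ltac:(lia) Hpos); rewrite Dx0, Dx1 in Hx.
    assert (y 1%nat = 0) by nra.
    nra. }
  assert (Hcont : x 0%nat = 1) by lra.
  assert (y 1%nat = 0).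
  { destruct (Rle_lt_or_eq_dec 0 (y 1%nat) Hy1) as [Hpos | <-]; [exfalso | reflexivity].
    specialize (Hy 1%nat 0%nat ltac:(lia) ltac:(lia) Hpos); rewrite Dy0, Dy1, Hcont in Hy.
    lra. }
  repeat split; lra.
Qed.

Lemma cdt_eq_absent_game_U : cdt_eq G pi -> U G P1 pi = 1 /\ U G P2 pi = 1.
Proof.
  intros Hcdt; rewrite U_absent_game_P1, U_absent_game_P2.
  fold (x 0%nat) (x 1%nat) (y 0%nat) (y 1%nat).
  destruct (cdt_eq_absent_game Hcdt) as (-> & -> & -> & ->); split; ring.
Qed.

Lemma edt_eq_absent_game_U : edt_eq G pi -> U G P1 pi = 1.
Proof.
  intros [Hvalid Hbest].
  destruct (proj1 (is_distr_two _) (Hvalid P1 _ _ absent_game_infoset_P1))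
    as (Hx0 & Hx1 & Hxsum).
  destruct (proj1 (is_distr_two _) (Hvalid P2 _ _ absent_game_infoset_P2))
    as (Hy0 & Hy1 & Hysum).
  pose proof (Hbest P1 true 2%nat absent_game_infoset_P1 (pure 0)
                (pure_is_distr_two 0 ltac:(lia))) as Hdev1.
  pose proof (Hbest P2 false 2%nat absent_game_infoset_P2 (pure 0)
                (pure_is_distr_two 0 ltac:(lia))) as Hdev2.
  rewrite !U_absent_game_P1 in Hdev1; rewrite !U_absent_game_P2 in Hdev2.
  unfold set_infoset, set_player, pure in Hdev1, Hdev2; simpl in Hdev1, Hdev2.
  rewrite U_absent_game_P1.
  fold (x 0%nat) (x 1%nat) (y 0%nat) (y 1%nat) in *.
  assert (Hcont : x 0%nat = 1).
  { replace (x 1%nat) with (1 - x 0%nat) in Hdev1 by lra.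
    (* Hdev1 rearranges to (1 - x 0) * (y 0 * (1 - x 0 / 2) + y 1 * d) <= 0. *)
    assert (y 0%nat * (1 - x 0%nat / 2) + y 1%nat * d > 0) by nra.
    nra. }
  rewrite Hcont in Hdev2 |- *.
  assert (y 1%nat = 0) by nra.
  replace (x 1%nat) with 0 by lra; replace (y 0%nat) with 1 by lra.
  nra.
Qed.

End Equilibria.

Section Pr1Equilibria.

Variable pi : profile (pr1 G).
Let x a := pi P1 visit1 a.
Let z a := pi P1 visit2 a.
Let y a := pi P2 turn2 a.

Lemma cdt_eq_pr1_absent_game_U :
  cdt_eq (pr1 G) pi -> U (pr1 G) P1 pi = d /\ U (pr1 G) P2 pi = d.
Proof.
  intros Hcdt.
  pose proof (KKT_point_support_max (Hcdt P1) pr1_absent_game_infoset_visit1) as Hx.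
  pose proof (KKT_point_support_max (Hcdt P1) pr1_absent_game_infoset_visit2) as Hz.
  pose proof (KKT_point_support_max (Hcdt P2) pr1_absent_game_infoset_turn2) as Hy.
  destruct (proj1 (is_distr_two _) (proj1 (Hcdt P1) _ _ pr1_absent_game_infoset_visit1))
    as (Hx0 & Hx1 & Hxsum).
  destruct (proj1 (is_distr_two _) (proj1 (Hcdt P1) _ _ pr1_absent_game_infoset_visit2))
    as (Hz0 & Hz1 & Hzsum).
  destruct (proj1 (is_distr_two _) (proj1 (Hcdt P2) _ _ pr1_absent_game_infoset_turn2))
    as (Hy0 & Hy1 & Hysum).
  destruct (partialU_pr1_absent_game_visit1 pi) as [Dx0 Dx1].
  destruct (partialU_pr1_absent_game_visit2 pi) as [Dz0 Dz1].
  destruct (partialU_pr1_absent_game_turn2 pi) as [Dy0 Dy1].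
  rewrite U_pr1_absent_game_P1, U_pr1_absent_game_P2.
  fold (x 0%nat) (x 1%nat) (z 0%nat) (z 1%nat) (y 0%nat) (y 1%nat) in *.
  assert (Hexit : x 1%nat = 0).
  { destruct (Rle_lt_or_eq_dec 0 (x 1%nat) Hx1) as [Hpos | <-]; [exfalso | reflexivity].
    specialize (Hx 1%nat 0%nat ltac:(lia) ltac:(lia) Hpos); rewrite Dx0, Dx1 in Hx.
    assert (y 0%nat * (z 0%nat + 3/2 * z 1%nat) >= y 0%nat) by nra.
    nra. }
  assert (Hcont : x 0%nat = 1) by lra.
  assert (Hy0z : y 0%nat = 0).
  { destruct (Rle_lt_or_eq_dec 0 (y 0%nat) Hy0) as [Hpos | <-]; [exfalso | reflexivity].
    specialize (Hy 0%nat 1%nat ltac:(lia) ltac:(lia) Hpos); rewrite Dy0, Dy1, Hcont in Hy.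
    assert (Hstay : 0 < z 0%nat) by nra.
    specialize (Hz 0%nat 1%nat ltac:(lia) ltac:(lia) Hstay); rewrite Dz0, Dz1, Hcont in Hz.
    lra. }
  rewrite Hcont, Hy0z; replace (y 1%nat) with 1 by lra; split; ring.
Qed.

Lemma edt_eq_pr1_absent_game_U : edt_eq (pr1 G) pi -> U (pr1 G) P1 pi = d.
Proof.
  intros [Hvalid Hbest].
  destruct (proj1 (is_distr_two _) (Hvalid P1 _ _ pr1_absent_game_infoset_visit1))
    as (Hx0 & Hx1 & Hxsum).
  destruct (proj1 (is_distr_two _) (Hvalid P1 _ _ pr1_absent_game_infoset_visit2))
    as (Hz0 & Hz1 & Hzsum).
  destruct (proj1 (is_distr_two _) (Hvalid P2 _ _ pr1_absent_game_infoset_turn2))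
    as (Hy0 & Hy1 & Hysum).
  pose proof (Hbest P1 visit1 2%nat pr1_absent_game_infoset_visit1 (pure 0)
                (pure_is_distr_two 0 ltac:(lia))) as Hdev1.
  pose proof (Hbest P1 visit2 2%nat pr1_absent_game_infoset_visit2 (pure 1)
                (pure_is_distr_two 1 ltac:(lia))) as Hdev2.
  pose proof (Hbest P2 turn2 2%nat pr1_absent_game_infoset_turn2 (pure 1)
                (pure_is_distr_two 1 ltac:(lia))) as Hdev3.
  rewrite !U_pr1_absent_game_P1 in Hdev1, Hdev2; rewrite !U_pr1_absent_game_P2 in Hdev3.
  unfold set_infoset, set_player, pure in Hdev1, Hdev2, Hdev3; simpl in Hdev1, Hdev2, Hdev3.
  rewrite U_pr1_absent_game_P1.
  fold (x 0%nat) (x 1%nat) (z 0%nat) (z 1%nat) (y 0%nat) (y 1%nat) in *.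
  assert (Hcont : x 0%nat = 1).
  { assert (y 0%nat * (z 0%nat + 3/2 * z 1%nat) + y 1%nat * d > 0) by nra.
    nra. }
  rewrite Hcont in Hdev2, Hdev3 |- *.
  assert (y 0%nat * z 0%nat = 0) by nra.
  assert (Hy0z : y 0%nat = 0) by nra.
  rewrite Hy0z; replace (y 1%nat) with 1 by lra; ring.
Qed.

End Pr1Equilibria.

Definition always_continue : profile G := fun _ _ => pure 0.

Lemma always_continue_cdt_eq : cdt_eq G always_continue.
Proof.
  intros i; apply KKT_point_of_best_response with (best := fun _ => 0%nat).
  - intros I n HI; destruct (absent_game_infoset HI) as [-> _].
    apply pure_is_distr_two; lia.
  - intros I n a HI Ha; destruct (absent_game_infoset HI) as [-> [[-> ->] | [-> ->]]].
    + destruct a as [|[|a]]; [split; [apply Rle_refl | right; reflexivity] | | lia].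
      destruct (partialU_absent_game_P1 always_continue) as [-> ->].
      unfold always_continue, pure; simpl; split; [lra | left; reflexivity].
    + destruct a as [|[|a]]; [split; [apply Rle_refl | right; reflexivity] | | lia].
      destruct (partialU_absent_game_P2 always_continue) as [-> ->].
      unfold always_continue, pure; simpl; split; [lra | left; reflexivity].
Qed.

Lemma cdt_eq_absent_game_realization_equiv (pi : profile G) :
  cdt_eq G pi -> realization_equiv G always_continue pi.
Proof.
  intros Hcdt p _; apply reach_ext_decisions.
  intros q o J ch k c Hq Hk.
  assert (HI : is_infoset G o J (length ch)) by (exists q, ch; auto).
  destruct (absent_game_infoset HI) as [Hlen Howner].
  assert (Hk2 : (k < 2)%nat) by (rewrite <- Hlen; apply nth_error_Some; congruence).
  destruct (cdt_eq_absent_game pi Hcdt) as (Hx0 & Hx1 & Hy0 & Hy1).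
  unfold always_continue, pure.
  destruct Howner as [[-> ->] | [-> ->]]; destruct k as [|[|k]]; simpl; lra || lia.
Qed.

Lemma sc_eq_absent_game_U (SC : sol_concept) (pi : profile G) :
  sc_eq SC G pi -> U G P1 pi = 1.
Proof.
  destruct SC; simpl; intros Heq.
  1, 2: exact (proj1 (cdt_eq_absent_game_U pi Heq)).
  1, 2: exact (edt_eq_absent_game_U pi Heq).
  1, 2: apply edt_eq_absent_game_U, nash_eq_edt_eq; [apply absent_game_wf; lra | exact Heq].
Qed.

Lemma sc_eq_pr1_absent_game_U (SC : sol_concept) (pi : profile (pr1 G)) :
  sc_eq SC (pr1 G) pi -> U (pr1 G) P1 pi = d.
Proof.
  destruct SC; simpl; intros Heq.
  1, 2: exact (proj1 (cdt_eq_pr1_absent_game_U pi Heq)).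
  1, 2: exact (edt_eq_pr1_absent_game_U pi Heq).
  1, 2: apply edt_eq_pr1_absent_game_U, nash_eq_edt_eq;
    [apply pr1_absent_game_wf; lra | exact Heq].
Qed.

End AbsentMinded.

Theorem proposition2 :
  forall eps : R, 0 < eps ->
  exists G : game,
    wf_game G /\
    (* unique CDT equilibrium up to realization equivalence *)
    (exists pi0 : profile G, cdt_eq G pi0 /\
       forall pi : profile G, cdt_eq G pi -> realization_equiv G pi0 pi) /\
    (* utility ratios *)
    (forall (pi : profile G) (pi' : profile (pr1 G)) (i : player),
       cdt_eq G pi -> cdt_eq (pr1 G) pi' ->
       0 < U G i pi /\ U (pr1 G) i pi' / U G i pi <= eps) /\
    (* in particular, VoR^SC(G) <= eps (whenever defined), for all six SC *)
    (forall (SC : sol_concept) (r : R), VoR SC G r -> r <= eps).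
Proof.
  intros eps Heps.
  set (d := Rmin eps (1/2)).
  assert (d_pos : 0 < d) by (unfold d; apply Rmin_glb_lt; lra).
  assert (d_lt1 : d < 1) by (pose proof (Rmin_r eps (1/2)); unfold d; lra).
  assert (d_le_eps : d <= eps) by apply Rmin_l.
  clearbody d.
  exists (absent_game d); split; [| split; [| split]].
  - apply absent_game_wf; lra.
  - exists (always_continue d); split.
    + apply always_continue_cdt_eq; assumption.
    + apply cdt_eq_absent_game_realization_equiv; assumption.
  - intros pi pi' i Hcdt Hcdt'.
    destruct (cdt_eq_absent_game_U d d_pos d_lt1 pi Hcdt) as [U1 U2].
    destruct (cdt_eq_pr1_absent_game_U d d_pos d_lt1 pi' Hcdt') as [U1' U2'].
    destruct i; [rewrite U1, U1' | rewrite U2, U2']; rewrite Rdiv_1_r; lra.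
  - intros SC r (v & v' & [[pi [Hpi <-]] _] & [[pi' [Hpi' <-]] _] & _ & ->).
    rewrite (sc_eq_absent_game_U d d_pos d_lt1 SC pi Hpi),
            (sc_eq_pr1_absent_game_U d d_pos d_lt1 SC pi' Hpi'), Rdiv_1_r.
    exact d_le_eps.
Qed.
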